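(* For every integer $m\ge 2$, the following identity holds in $\mathbb{Z}[a_0,\ldots,a_m]$: $$H_{m-2,1,1}(m) = D(m,m-3)-D(m,m-2)^2 .$$
   Context: Let $m\ge 2$ and let $a_0,\ldots,a_m$ be independent commuting variables over $\mathbb{Z}$; put $a_l:=0$ for every integer $l\notin\{0,\ldots,m\}$. Let $t,T$ be further commuting variables. Let $\mathcal M_1$ be the $m\times m$ matrix over $\mathbb{Z}[a_0,\ldots,a_m][t]$ with $(i,j)$-th entry $a_{2j-i}\,t-a_{2j-i-1}$ ($1\le i,j\le m$). The polynomials $H_{i,j,1}(m)\in\mathbb{Z}[a_0,\ldots,a_m]$ are defined by $$\det(I_m-\mathcal M_1T)=\sum_{i=0}^{m}\sum_{j=0}^{m-i}H_{i,j,1}(m)\,t^jT^{m-i}.$$ Let $\mathcal M_0$ be the $(m-1)\times(m-1)$ matrix over $\mathbb{Z}[a_0,\ldots,a_m]$ with $(i,j)$-th entry $a_{2j-i}$ ($1\le i,j\le m-1$). The polynomials $D(m,i)\in\mathbb{Z}[a_0,\ldots,a_m]$ are defined for $i\in\{0,\ldots,m-1\}$ by $$\det(I_{m-1}-\mathcal M_0T)=\sum_{i=0}^{m-1}D(m,i)\,T^{m-1-i},$$ and $D(m,i):=0$ for $i\notin\{0,\ldots,m-1\}$. *)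

(* Defs.v *)
From mathcomp Require Import all_boot all_order all_algebra all_fingroup.
From mathcomp Require Import mpoly.

Set Implicit Arguments.
Unset Strict Implicit.
Unset Printing Implicit Defensive.

Import Order.TTheory GRing.Theory Num.Theory.

Local Open Scope ring_scope.

(* The variable a_l of Z[a_0, ..., a_m], extended by 0 to all integers l. *)
Definition a_ (m : nat) (l : int) : {mpoly int[m.+1]} :=
  if (0 <= l <= m%:Z) then 'X_(inord (absz l)) else 0.

(* Ordinals start at 0, hence the successors; here 'X is t. *)
Definition M1 (m : nat) : 'M[{poly {mpoly int[m.+1]}}]_m :=
  \matrix_(i < m, j < m)
    ((a_ m (2 * j.+1%:Z - i.+1%:Z))%:P * 'X
     - (a_ m (2 * j.+1%:Z - i.+1%:Z - 1))%:P).

Definition M0 (m : nat) : 'M[{mpoly int[m.+1]}]_(m.-1) :=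
  \matrix_(i < m.-1, j < m.-1) a_ m (2 * j.+1%:Z - i.+1%:Z).

(* det (I_n - A T), where T is the outermost polynomial variable. *)
Definition detT (R : comNzRingType) (n : nat) (A : 'M[R]_n) : {poly R} :=
  \det (1%:M - 'X *: map_mx polyC A).

(* Meaningful for i <= m only; see detT_M1E. *)
Definition H1 (m i j : nat) : {mpoly int[m.+1]} := (detT (M1 m))`_(m - i)`_j.

Definition D (m : nat) (i : int) : {mpoly int[m.+1]} :=
  if (0 <= i <= m%:Z - 1) then (detT (M0 m))`_(absz (m%:Z - 1 - i)%R) else 0.

Lemma size_detT (R : comNzRingType) (n : nat) (A : 'M[R]_n) :
  (size (detT A) <= n.+1)%N.
Proof.
rewrite /detT /determinant; apply: (leq_trans (size_sum _ _ _)).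
apply/bigmax_leqP => s _; rewrite -signr_odd mulr_sign.
have szp : (size (\prod_(i < n) (1%:M - 'X *: map_mx polyC A) i ((s : {perm 'I_n}) i))%R
            <= n.+1)%N.
  apply: (leq_trans (size_poly_prod_leq _ _)).
  rewrite leq_subLR cardT size_enum_ord addnS ltnS addnn -mul2n mulnC.
  rewrite -[X in (_ <= X * 2)%N](card_ord n) -sum_nat_const.
  apply: leq_sum => i _; rewrite !mxE.
  apply: (leq_trans (size_polyD _ _)); rewrite size_polyN geq_max.
  apply/andP; split; first by case: (_ == _); rewrite ?size_poly0 ?size_poly1.
  rewrite mulrC; apply: (leq_trans (size_polyMleq _ _)).
  by rewrite size_polyX addn2 ltnS size_polyC_leq1.
by case: (odd _); rewrite ?size_polyN.
Qed.

Lemma size_coef_detT (R : comNzRingType) (n : nat) (A : 'M[{poly R}]_n)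
    (k : nat) :
  (forall i j, (size (A i j) <= 2)%N) -> (size ((detT A)`_k)%R <= k.+1)%N.
Proof.
move=> szA.
pose P (p : {poly {poly R}}) := forall k, (size (p`_k)%R <= k.+1)%N.
have PD p q : P p -> P q -> P (p + q).
  move=> Pp Pq l; rewrite coefD; apply: (leq_trans (size_polyD _ _)).
  by rewrite geq_max Pp Pq.
have PN p : P p -> P (- p) by move=> Pp l; rewrite coefN size_polyN.
have P0 : P 0 by move=> l; rewrite coef0 size_poly0.
have P1 : P 1.
  by move=> l; rewrite coef1; case: (l == 0)%N; rewrite ?size_poly0 ?size_poly1.
have PM p q : P p -> P q -> P (p * q).
  move=> Pp Pq l; rewrite coefM; apply: (leq_trans (size_sum _ _ _)).
  apply/bigmax_leqP => i _; apply: (leq_trans (size_polyMleq _ _)).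
  rewrite -ltnS; have := leq_add (Pp i) (Pq (l - i)%N).
  rewrite addSn addnS subnKC -1?ltnS // => le_l.
  by case: (_ + _)%N le_l.
suff PA : P (detT A) by apply: PA.
rewrite /detT /determinant; apply: (big_ind P); [exact: P0|exact: PD|] => s _.
apply: (PM); first by rewrite -signr_odd; case: (odd _) => //=; apply: (PN).
apply: (big_ind P); [exact: P1|exact: PM|] => i _; rewrite !mxE; apply: PD.
  by case: (_ == _).
apply: PN; case=> [|[|l]]; rewrite coefXM ?size_poly0 //= coefC /= ?size_poly0 //.
Qed.

(* The coefficient of T^k has t-degree at most k. *)
Lemma size_coef_detT_M1 (m k : nat) : (size ((detT (M1 m))`_k)%R <= k.+1)%N.
Proof.
apply: size_coef_detT => i j; rewrite mxE.
apply: (leq_trans (size_polyD _ _)); rewrite size_polyN geq_max.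
rewrite (leq_trans (size_polyC_leq1 _)) // andbT.
apply: (leq_trans (size_polyMleq _ _)).
by rewrite size_polyX addn2 ltnS size_polyC_leq1.
Qed.

Lemma poly_sum_rev (R : nzRingType) (n : nat) (p : {poly R}) :
  (size p <= n.+1)%N -> p = \sum_(0 <= i < n.+1) (p`_(n - i))%:P * 'X^(n - i).
Proof.
move=> szp; rewrite big_nat_rev big_mkord /=; apply/polyP => k.
rewrite coef_sum; under eq_bigr => i _.
  rewrite add0n subSS subKn -1?ltnS // coefCM coefXn; over.
have [lt_kn|le_nk] := ltnP k n.+1; last first.
  rewrite nth_default ?(leq_trans szp) // big1 // => i _.
  by rewrite gtn_eqF ?mulr0 // (leq_trans (ltn_ord i)).
rewrite (bigD1 (Ordinal lt_kn)) //= eqxx mulr1 big1 ?addr0 // => i ne_ik.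
rewrite [k == i]eq_sym; case: eqP => [eq_ik|_]; last by rewrite mulr0.
by case/eqP: ne_ik; apply: val_inj.
Qed.

Lemma poly_sum (R : nzRingType) (n : nat) (p : {poly R}) :
  (size p <= n.+1)%N -> p = \sum_(0 <= i < n.+1) (p`_i)%:P * 'X^i.
Proof.
move=> szp; rewrite {1}(poly_sum_rev szp) big_nat_rev /=.
by apply: eq_big_nat => i /= lt_in; rewrite add0n subSS subKn -1?ltnS.
Qed.

(* The expansions by which the H1 m i j and the D m i are defined. *)
Lemma detT_M1E (m : nat) :
  detT (M1 m) = \sum_(0 <= i < m.+1) \sum_(0 <= j < (m - i).+1)
                  (H1 m i j)%:P%:P * ('X^j)%:P * 'X^(m - i).
Proof.
rewrite [LHS](poly_sum_rev (size_detT _)); apply: eq_big_nat => i _.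
rewrite {1}(poly_sum (size_coef_detT_M1 m (m - i))) rmorph_sum mulr_suml.
by apply: eq_bigr => j _; rewrite rmorphM.
Qed.

Lemma detT_M0E (m : nat) : (0 < m)%N ->
  detT (M0 m) = \sum_(0 <= i < m) (D m i%:Z)%:P * 'X^(m - 1 - i).
Proof.
case: m => // m _; rewrite [LHS](poly_sum_rev (size_detT _)).
apply: eq_big_nat => i /= lt_im; rewrite subSS subn0 /D.
have -> : m.+1%:Z - 1 = m%:Z by rewrite -addn1 PoszD addrK.
by rewrite !lez_nat /= -ltnS lt_im subzn.
Qed.

(* Main.v *)
(** Newton's identities express the coefficients of T and T^2 in det (I - A T)
    by the traces of A and A^2; they follow from Jacobi's formula for the
    derivative of a determinant and from M adj M = (det M) I. Write M1 = A t - B.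
    The product a_p a_q, for 0 <= p, q <= m, occurs exactly once in tr (A B)
    if p = q + 1 mod 3, exactly once in tr (M0^2) if p = q mod 3 (up to
    p = q = 0 and p = q = m), and nowhere else. Summing over the three residue
    classes of p - q, where those of 1 and -1 are exchanged by swapping p and q,
    2 tr (A B) + tr (M0^2) + a_0^2 + a_m^2 = (a_0 + ... + a_m)^2, which is
    equivalent to twice the claim. *)

Require Import Defs.
From mathcomp Require Import all_boot all_order all_algebra.
From mathcomp Require Import perm mpoly zify ring.

Import Order.TTheory GRing.Theory Num.Theory.

Local Open Scope ring_scope.

(** * Jacobi's formula for the derivative of a determinant *)

Lemma deriv_prod (R : comNzRingType) (I : finType) (F : I -> {poly R}) :
  (\prod_i F i)^`() = \sum_i (F i)^`() * \prod_(j | j != i) F j.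
Proof.
pose G (i j : I) : {poly R} := if j == i then (F j)^`() else F j.
have Gii i : G i i = (F i)^`() by rewrite /G eqxx.
have Gij i j : j != i -> G i j = F j by rewrite /G => /negPf ->.
(* Without repetitions in [r], differentiating the head factor leaves the tail factors alone, and
   conversely. *)
have step (r : seq I) : uniq r ->
    (\prod_(j <- r) F j)^`() = \sum_(i <- r) \prod_(j <- r) G i j.
  elim: r => [|x r IH] /=; first by rewrite !big_nil -polyC1 derivC.
  case/andP=> xr /IH {}IH; rewrite !big_cons derivM IH Gii.
  congr (_ * _ + _).
    by apply: eq_big_seq => j jr; rewrite Gij // (memPn xr).
  rewrite mulr_sumr; apply: eq_big_seq => i ir; rewrite big_cons Gij //.
  by rewrite eq_sym (memPn xr).
rewrite step ?index_enum_uniq //; apply: eq_bigr => i _.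
by rewrite (bigD1 i) //= Gii; congr (_ * _); apply: eq_bigr => j /Gij.
Qed.

(** The product rule in each Leibniz term yields the determinants of the [N k], where only row [k]
    is differentiated; the cofactors along row [k] do not see that change. *)
Lemma deriv_det (R : comNzRingType) (n : nat) (M : 'M[{poly R}]_n) :
  (\det M)^`() = \sum_i \sum_j (M i j)^`() * cofactor M i j.
Proof.
pose N k : 'M_n := \matrix_(i, j) if i == k then (M i j)^`() else M i j.
transitivity (\sum_k \det (N k)).
  rewrite /determinant raddf_sum exchange_big /=; apply: eq_bigr => s _.
  rewrite -signr_odd mulr_sign -mulr_sumr mulr_sign.
  rewrite (fun_if (@deriv R)) derivN deriv_prod.
  have -> : \sum_i (M i (s i))^`() * \prod_(j | j != i) M j (s j)
          = \sum_i \prod_j N i j (s j) => //.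
  apply: eq_bigr => i _; rewrite [RHS](bigD1 i) //= mxE eqxx; congr (_ * _).
  by apply: eq_bigr => j /negPf ji; rewrite mxE ji.
apply: eq_bigr => k _; rewrite (expand_det_row _ k); apply: eq_bigr => j _.
rewrite mxE eqxx; congr (_ * (_ * \det _)).
by apply/matrixP => x y; rewrite !mxE eq_sym (negPf (neq_lift _ _)).
Qed.

(** * Low coefficients of det (I - A T) *)

Section Newton.

Variables (R : comNzRingType) (n : nat) (A : 'M[R]_n).

Let M := 1%:M - 'X *: map_mx polyC A.
Let C k : 'M[R]_n := \matrix_(i, j) (\adj M i j)`_k.

(** Compares coefficients of T^k in M adj M = (det M) I. *)
Let coefM_adj i j k :
  C k i j - (if k is l.+1 then (A *m C l) i j else 0)
  = (detT A)`_k *+ (i == j).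
Proof.
have := congr1 (fun B : 'M[{poly R}]_n => (B i j)`_k) (mul_mx_adj M).
rewrite mulmxBl mul1mx -scalemxAl !mxE coefB coefMn coefXM => <-.
congr (_ - _); case: k => //= l.
by rewrite !mxE coef_sum; apply: eq_bigr => x _; rewrite !mxE coefCM.
Qed.

(** Jacobi's formula for [M], whose derivative is [- A]; as [\adj M] is the transposed cofactor
    matrix, the double sum is a trace. *)
Let newton k : (detT A)`_k.+1 *+ k.+1 = - \tr (A *m C k).
Proof.
rewrite -coef_deriv deriv_det coef_sum -sumrN; apply: eq_bigr => i _.
rewrite mxE coef_sum -sumrN; apply: eq_bigr => j _.
rewrite !mxE derivB derivM derivX derivC mulr0 addr0 mul1r.
have -> : (1 *+ (i == j) : {poly R})^`() = 0 by rewrite derivMn derivC mul0rn.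
by rewrite sub0r mulNr coefN coefCM.
Qed.

Lemma detT_coef0 : (detT A)`_0 = 1.
Proof.
rewrite -horner_coef0 /detT -horner_evalE -det_map_mx.
have -> : map_mx (horner_eval 0) (1%:M - 'X *: map_mx polyC A) = 1%:M.
  apply/matrixP => i j; rewrite !mxE /horner_eval !hornerE.
  by rewrite subr0 -polyC_natr hornerC.
exact: det1.
Qed.

Let C0 : C 0 = 1%:M.
Proof.
apply/matrixP => i j; have := coefM_adj i j 0.
by rewrite subr0 detT_coef0 => ->; rewrite mxE.
Qed.

Lemma detT_coef1 : (detT A)`_1 = - \tr A.
Proof. by have := newton 0; rewrite C0 mulmx1. Qed.

Let C1 : C 1 = A - (\tr A)%:M.
Proof.
apply/matrixP => i j; have /eqP := coefM_adj i j 1.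
rewrite subr_eq C0 mulmx1 detT_coef1 => /eqP ->.
by rewrite !mxE mulNrn addrC.
Qed.

Lemma detT_coef2 : (detT A)`_2 *+ 2 = \tr A ^+ 2 - \tr (A *m A).
Proof.
rewrite newton C1 mulmxBr mul_mx_scalar raddfB /= mxtraceZ; ring.
Qed.

End Newton.

(** * Double sums of products sorted by residues mod 3 *)

Section ResidueClasses.

Variables (R : comNzRingType) (m : nat) (a : int -> R).
Hypothesis a_out : forall l : int, ~~ (0 <= l <= m%:Z) -> a l = 0.

(* Row and column are recovered from the two indices p = 2j - i and
   q = 2i - j - d by p + 2q + 2d = 3i and 2p + q + d = 3j. *)
Lemma sum_residue (k d : nat) :
  \sum_(i < k.+1) \sum_(j < k.+1)
     a (2 * j.+1%:Z - i.+1%:Z) * a (2 * i.+1%:Z - j.+1%:Z - d%:Z)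
  = \sum_(p < m.+1) \sum_(q < m.+1 | [&& 3 %| p + 2 * q + 2 * d,
       2 < p + 2 * q + 2 * d < 3 * k + 6 & 2 < 2 * p + q + d < 3 * k + 6]%N)
     a p%:Z * a q%:Z.
Proof.
rewrite pair_big /= pair_big_dep /=.
(* Outside [ins] a factor vanishes; inside, the truncated subtractions of [h'] are exact. *)
pose ins (x : 'I_k.+1 * 'I_k.+1) :=
  (0 <= 2 * x.2.+1%:Z - x.1.+1%:Z <= m%:Z) &&
  (0 <= 2 * x.1.+1%:Z - x.2.+1%:Z - d%:Z <= m%:Z).
rewrite (bigID ins) /= [X in _ + X]big1 ?addr0; last first.
  move=> x; rewrite negb_and => /orP[] /a_out ->; by rewrite ?mul0r ?mulr0.
pose h (y : 'I_m.+1 * 'I_m.+1) : 'I_k.+1 * 'I_k.+1 :=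
  (inord ((y.1 + 2 * y.2 + 2 * d) %/ 3).-1, inord ((2 * y.1 + y.2 + d) %/ 3).-1).
pose h' (x : 'I_k.+1 * 'I_k.+1) : 'I_m.+1 * 'I_m.+1 :=
  (inord (2 * x.2.+1 - x.1.+1), inord (2 * x.1.+1 - x.2.+1 - d)).
rewrite (reindex_onto h h'); last first.
  case=> i j; rewrite /ins /h /h' /= => ins_ij.
  have p_lt : (2 * j.+1 - i.+1 < m.+1)%N by lia.
  have q_lt : (2 * i.+1 - j.+1 - d < m.+1)%N by lia.
  rewrite !inordK //.
  have -> : (2 * j.+1 - i.+1 + 2 * (2 * i.+1 - j.+1 - d) + 2 * d = 3 * i.+1)%N by lia.
  have -> : (2 * (2 * j.+1 - i.+1) + (2 * i.+1 - j.+1 - d) + d = 3 * j.+1)%N by lia.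
  by rewrite !mulKn // !inord_val.
have fixed (y : 'I_m.+1 * 'I_m.+1) : ins (h y) && (h' (h y) == y) ->
    (2 * (h y).2.+1%:Z - (h y).1.+1%:Z = y.1%:Z)
    * (2 * (h y).1.+1%:Z - (h y).2.+1%:Z - d%:Z = y.2%:Z).
  case/andP; rewrite /ins /h'; case: (h y) => i j /= ins_ij /eqP <- /=.
  by rewrite !inordK; try split; lia.
apply: eq_big => [[p q]|y] /=; last by move=> /fixed fy; rewrite !fy.
apply/idP/idP => [/fixed|].
  case: (h _) => i j /= [eq_p eq_q].
  have -> : (p + 2 * q + 2 * d = 3 * i.+1)%N by lia.
  have -> : (2 * p + q + d = 3 * j.+1)%N by lia.
  by have := ltn_ord i; have := ltn_ord j; rewrite dvdn_mulr //; lia.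
(* The other numerator is a multiple of 3 too, since both add up to 3(p + q + d). *)
case/and3P=> dvd3 lt_i lt_j.
pose i := ((p + 2 * q + 2 * d) %/ 3).-1; pose j := ((2 * p + q + d) %/ 3).-1.
have eq_i : (p + 2 * q + 2 * d = 3 * i.+1)%N by rewrite /i; lia.
have eq_j : (2 * p + q + d = 3 * j.+1)%N by rewrite /j; lia.
rewrite /ins /h /h' /= -/i -/j !inordK; try lia.
have := ltn_ord p; have := ltn_ord q => lt_q lt_p.
apply/andP; split; first by lia.
have -> : (2 * j.+1 - i.+1 = p)%N by lia.
have -> : (2 * i.+1 - j.+1 - d = q)%N by lia.
by rewrite !inord_val.
Qed.

(** The first condition says p = q + 1 mod 3, the second p = q. Swapping p and q in one copy of the
    first sum supplies the remaining class. *)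
Lemma sum_residue_split :
  (\sum_(p < m.+1) \sum_(q < m.+1 | (3 %| p + 2 * q + 2)%N) a p%:Z * a q%:Z) *+ 2
  + \sum_(p < m.+1) \sum_(q < m.+1 | (3 %| p + 2 * q)%N) a p%:Z * a q%:Z
  = (\sum_(p < m.+1) a p%:Z) ^+ 2.
Proof.
rewrite mulr2n [X in _ + X + _](exchange_big_dep xpredT) //= -!big_split /= expr2 mulr_suml.
apply: eq_bigr => p _; rewrite mulr_sumr.
rewrite [RHS](bigID (fun q : 'I_m.+1 => (3 %| p + 2 * q + 2)%N)) /=.
rewrite [X in _ = _ + X](bigID (fun q : 'I_m.+1 => (3 %| p + 2 * q)%N)) /=.
rewrite -addrA; congr (_ + _); rewrite addrC; congr (_ + _).
  by apply: eq_bigl => q; lia.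
by apply: eq_big => [q|q _]; [lia | rewrite mulrC].
Qed.

(** For d = 1 and k = m - 1, divisibility by 3 and p, q <= m already force the bounds. *)
Lemma sum_residue1 : (0 < m)%N ->
  \sum_(i < m) \sum_(j < m)
     a (2 * j.+1%:Z - i.+1%:Z) * a (2 * i.+1%:Z - j.+1%:Z - 1)
  = \sum_(p < m.+1) \sum_(q < m.+1 | (3 %| p + 2 * q + 2)%N) a p%:Z * a q%:Z.
Proof.
move=> m_gt0; have := sum_residue m.-1 1; rewrite prednK // => ->.
apply: eq_bigr => p _; apply: eq_bigl => q.
have := ltn_ord p; have := ltn_ord q; lia.
Qed.

(** For d = 0 and k = m - 2, the bounds exclude exactly the multiples 0 and 3m, that is p = q = 0
    and p = q = m; the two squares restore them. *)
Lemma sum_residue0 : (1 < m)%N ->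
  \sum_(i < m.-1) \sum_(j < m.-1)
     a (2 * j.+1%:Z - i.+1%:Z) * a (2 * i.+1%:Z - j.+1%:Z)
  + a 0 ^+ 2 + a m%:Z ^+ 2
  = \sum_(p < m.+1) \sum_(q < m.+1 | (3 %| p + 2 * q)%N) a p%:Z * a q%:Z.
Proof.
move=> m_gt1; have := sum_residue m.-2 0.
under eq_bigr => i _ do under eq_bigr => j _ do rewrite subr0.
have -> : m.-2.+1 = m.-1 by lia.
move=> ->; rewrite !pair_big_dep /=.
rewrite [RHS](bigD1 (ord0, ord0)) //= [X in _ = _ + X](bigD1 (ord_max, ord_max)) /=;
  last by rewrite xpair_eqE -!val_eqE /=; lia.
rewrite -!expr2 [RHS]addrC addrAC [RHS]addrAC -addrA [RHS]addrC -[RHS]addrA.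
rewrite [LHS]addrC [a m ^+ 2 + _]addrC -addrA; congr (_ + (_ + _)).
apply: eq_bigl => -[p q]; rewrite !xpair_eqE -!val_eqE /=.
have := ltn_ord p; have := ltn_ord q; lia.
Qed.

End ResidueClasses.

(** * Comparison of the traces *)

Lemma coef1_mul_linear (R : comNzRingType) (x y z w : R) :
  ((x%:P * 'X - y%:P) * (z%:P * 'X - w%:P))`_1 = - (x * w) - z * y.
Proof.
rewrite coefM !big_ord_recl big_ord0 /= !coefB !coefCM !coefX !coefC /=.
ring.
Qed.

Lemma mpoly_mulr2n_inj (n : nat) (x y : {mpoly int[n]}) : x *+ 2 = y *+ 2 -> x = y.
Proof.
move=> eq_xy; apply: (@mulfI _ 2%:R); last by rewrite !mulr_natl.
by rewrite -mpolyC_nat mpolyC_eq0.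
Qed.

Theorem theorem2p1 (m : nat) (hm : (2 <= m)%N) :
  H1 m (m - 2)%N 1%N = D m (m%:Z - 3) - D m (m%:Z - 2) ^+ 2.
Proof.
have a_out (l : int) : ~~ (0 <= l <= m%:Z) -> a_ m l = 0.
  by rewrite /a_ => /negPf ->.
set s := \sum_(i < m.-1) a_ m i.+1%:Z.
have sE : \sum_(p < m.+1) a_ m p%:Z = a_ m 0 + s + a_ m m%:Z.
  by rewrite /s; case: (m) hm => [|k] // _; rewrite big_ord_recl big_ord_recr addrA.
have trM0 : \tr (M0 m) = s.
  by apply: eq_bigr => i _; rewrite mxE; congr (a_ m _); lia.
have D1 : D m (m%:Z - 2) = - s.
  rewrite -trM0 -detT_coef1 /D ifT; last by lia.
  by congr (_ `_ _); lia.
have D2 : D m (m%:Z - 3) = (detT (M0 m))`_2.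
  rewrite /D; case: ifP => m3; first by congr (_ `_ _); lia.
  (* Here m = 2: [D] is 0 by convention, and the determinant has degree at most 1 in T. *)
  by rewrite nth_default // (leq_trans (size_detT _)) //; lia.
have H2 : H1 m (m - 2) 1 *+ 2 = (\tr (M1 m) ^+ 2 - \tr (M1 m *m M1 m))`_1.
  by rewrite -detT_coef2 coefMn /H1 subKn.
have trM1 : \tr (M1 m) = (s + a_ m m%:Z)%:P * 'X - (a_ m 0 + s)%:P.
  have -> : s + a_ m m%:Z = \sum_(i < m) a_ m i.+1%:Z.
    by rewrite /s; case: (m) hm => [|k] // _; rewrite big_ord_recr.
  have -> : a_ m 0 + s = \sum_(i < m) a_ m i%:Z.
    by rewrite /s; case: (m) hm => [|k] // _; rewrite big_ord_recl.
  rewrite !rmorph_sum mulr_suml -sumrB; apply: eq_bigr => i _; rewrite mxE.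
  have -> : 2 * i.+1%:Z - i.+1%:Z = i.+1%:Z by lia.
  by have -> : i.+1%:Z - 1 = i%:Z by lia.
set AB := \sum_(p < m.+1) \sum_(q < m.+1 | (3 %| p + 2 * q + 2)%N)
  a_ m p%:Z * a_ m q%:Z.
(* With M1 = A t - B, [AB] is tr (A B); the two mixed products have equal traces after exchanging i
   and j. *)
have trM1M1 : (\tr (M1 m *m M1 m))`_1 = - AB *+ 2.
  rewrite /AB -sum_residue1 // ?(ltnW hm) //.
  rewrite mulNrn mulr2n opprD {2}exchange_big -!sumrN -big_split /= coef_sum.
  apply: eq_bigr => i _; rewrite mxE coef_sum -!sumrN -big_split /=.
  by apply: eq_bigr => j _; rewrite !mxE coef1_mul_linear.
have trM0M0 : \tr (M0 m *m M0 m) =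
    \sum_(i < m.-1) \sum_(j < m.-1)
     a_ m (2 * j.+1%:Z - i.+1%:Z) * a_ m (2 * i.+1%:Z - j.+1%:Z).
  by apply: eq_bigr => i _; rewrite mxE; apply: eq_bigr => j _; rewrite !mxE.
have H := @sum_residue_split _ m (a_ m); rewrite -/AB -sum_residue0 // sE in H.
have eq_AB : AB *+ 2 = (a_ m 0 + s + a_ m m%:Z) ^+ 2
    - (\tr (M0 m *m M0 m) + a_ m 0 ^+ 2 + a_ m m%:Z ^+ 2).
  by rewrite -H trM0M0 addrK.
(* Twice either side equals - s^2 - tr (M0^2). *)
apply: mpoly_mulr2n_inj.
rewrite mulrnBl D1 D2 H2 detT_coef2 trM0 coefB trM1M1 trM1 expr2 coef1_mul_linear.
rewrite mulNrn opprK eq_AB.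
move: (s) (a_ m 0) (a_ m m) (\tr (M0 m *m M0 m)) => x y z w.
ring.
Qed.
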